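(* Let $G$ be a linearly ordered $d$-group. Let $(\overline S,S,\overset{\circ}{S},P)$ be either $(\overline{\mathscr{B}}(G),\mathscr{B}(G),\overset{\circ}{\mathscr{B}}(G),G)$ or $(\overline{\mathscr{B}}^+(G),\mathscr{B}^+(G),\overset{\circ}{\mathscr{B}}{}^+(G),G^+)$. Then the following assertions hold (all indices range over $P$). (i) $E(\overline S)=E(S)\cup E(\overset{\circ}{S})$. (ii) For $\alpha^g_g,\overset{\circ}{\alpha}{}^g_g,\alpha^h_h,\overset{\circ}{\alpha}{}^h_h\in E(\overline S)$: (a) $\alpha^g_g\preccurlyeq\alpha^h_h$ if and only if $g\geqslant h$; (b) $\overset{\circ}{\alpha}{}^g_g\preccurlyeq\overset{\circ}{\alpha}{}^h_h$ if and only if $g\geqslant h$; (c) $\alpha^g_g\preccurlyeq\overset{\circ}{\alpha}{}^h_h$ if and only if $g>h$; (d) $\overset{\circ}{\alpha}{}^g_g\preccurlyeq\alpha^h_h$ if and only if $g\geqslant h$. (iii) The semilattice $E(\overline S)$ is isomorphic to the lexicographic product $P\times_{\mathbf{lex}}\{0,1\}$ of the semilattices $(P,\vee)$ and $(\{0,1\},\min)$ under the mapping $(\alpha^g_g)\mathfrak{i}=(g,1)$ and $(\overset{\circ}{\alpha}{}^g_g)\mathfrak{i}=(g,0)$, and hence $E(\overline S)$ is a linearly ordered semilattice. (iv) If $\alpha,\beta\in\overline S$ are $\mathscr{R}$-equivalent in $\overline S$ then either $\alpha,\beta\in S$ or $\alpha,\beta\in\overset{\circ}{S}$; moreover, (a)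 $\alpha^g_h\mathscr{R}\alpha^k_l$ in $\overline S$ if and only if $g=k$, and (b) $\overset{\circ}{\alpha}{}^g_h\mathscr{R}\overset{\circ}{\alpha}{}^k_l$ in $\overline S$ if and only if $g=k$. (v) If $\alpha,\beta\in\overline S$ are $\mathscr{L}$-equivalent in $\overline S$ then either $\alpha,\beta\in S$ or $\alpha,\beta\in\overset{\circ}{S}$; moreover, (a) $\alpha^g_h\mathscr{L}\alpha^k_l$ in $\overline S$ if and only if $h=l$, and (b) $\overset{\circ}{\alpha}{}^g_h\mathscr{L}\overset{\circ}{\alpha}{}^k_l$ in $\overline S$ if and only if $h=l$. (vi) If $\alpha,\beta\in\overline S$ are $\mathscr{H}$-equivalent in $\overline S$ then either $\alpha,\beta\in S$ or $\alpha,\beta\in\overset{\circ}{S}$; moreover, (a) $\alpha^g_h\mathscr{H}\alpha^k_l$ in $\overline S$ if and only if $g=k$ and $h=l$, (b) $\overset{\circ}{\alpha}{}^g_h\mathscr{H}\overset{\circ}{\alpha}{}^k_l$ in $\overline S$ if and only if $g=k$ and $h=l$, and (c) every $\mathscr{H}$-class in $\overline S$ is a singleton set. (vii) $\overline S$ is a simple semigroup. (viii) $\overline S$ has only two distinct $\mathscr{D}$-classes, which are the inverse subsemigroups $S$ and $\overset{\circ}{S}$.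
   Context: A linearly ordered group is a group $G$ (identity $e$) with a total order $\leqslant$ such that $a\leqslant b$ implies $ag\leqslant bg$ and $ga\leqslant gb$ for all $a,b,g\in G$; $G^+=\{x\in G: e\leqslant x\}$; $\vee$ denotes maximum. $G$ is a $d$-group if for every $g\in G^+\setminus\{e\}$ there is $x\in G^+\setminus\{e\}$ with $x<g$. For $g,h\in G$, $\alpha^g_h$ (resp. $\overset{\circ}{\alpha}{}^g_h$) is the partial map $G\rightharpoonup G$ with domain $\{x\in G: g\leqslant x\}$ (resp. $\{x\in G: g<x\}$) given by $x\mapsto x g^{-1}h$. Put $\mathscr{B}(G)=\{\alpha^g_h: g,h\in G\}$, $\mathscr{B}^+(G)=\{\alpha^g_h: g,h\in G^+\}$, $\overset{\circ}{\mathscr{B}}(G)=\{\overset{\circ}{\alpha}{}^g_h: g,h\in G\}$, $\overset{\circ}{\mathscr{B}}{}^+(G)=\{\overset{\circ}{\alpha}{}^g_h: g,h\in G^+\}$, $\overline{\mathscr{B}}(G)=\overset{\circ}{\mathscr{B}}(G)\cup\mathscr{B}(G)$, $\overline{\mathscr{B}}^+(G)=\overset{\circ}{\mathscr{B}}{}^+(G)\cup\mathscr{B}^+(G)$. All are inverse semigroups under composition of partial maps (maps written on the right, $x(\alpha\beta)=(x\alpha)\beta$ for $x\in\operatorname{dom}\alpha$ with $x\alpha\in\operatorname{dom}\beta$). $E(T)$ is the set of idempotents of a semigroup $T$, with natural partial order $\varepsilon\preccurlyeq\iota$ iff $\varepsilon\iota=\iota\varepsilon=\varepsilon$; a semilattice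 is linearly ordered if this order is total. The lexicographic product $A\times_{\mathbf{lex}}B$ of posets is $A\times B$ with $(a,b)\leqslant(a',b')$ iff $a<a'$, or $a=a'$ and $b\leqslant b'$; here it is formed from the natural partial orders of the semilattices $(P,\vee)$ (in which $a\preccurlyeq b$ iff $a\geqslant b$ in $G$) and $(\{0,1\},\min)$, and the resulting chain is a semilattice under minimum. $\mathscr{R},\mathscr{L},\mathscr{H},\mathscr{D}$ are Green's relations of a semigroup $T$ ($a\mathscr{R}b$ iff $aT^1=bT^1$; $a\mathscr{L}b$ iff $T^1a=T^1b$; $\mathscr{H}=\mathscr{L}\cap\mathscr{R}$; $\mathscr{D}=\mathscr{L}\circ\mathscr{R}$), where $T^1$ is $T$ with an identity adjoined if necessary. A semigroup $T$ is simple if $T^1aT^1=T^1bT^1$ for all $a,b\in T$.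
   Formalization: In (vii), simplicity is stated only for nontrivial G: the trivial group is vacuously a d-group, and there the semigroup consists of the identity map and the empty map, which is not simple. *)

(* Defs.v *)
From HB Require Import structures.
From mathcomp Require Import all_boot all_order.
From mathcomp Require Import boolp classical_sets functions.

Set Implicit Arguments.
Unset Strict Implicit.
Unset Printing Implicit Defensive.

Import Order.TTheory.

Local Open Scope order_scope.
Local Open Scope group_scope.
Local Open Scope classical_set_scope.

HB.mixin Record isLinearlyOrderedGroup (d : Order.disp_t) G
    of Group G & Order.Total d G := {
  leMg2r : forall g a b : G, a <= b -> a * g <= b * g;
  leMg2l : forall g a b : G, a <= b -> g * a <= g * b
}.

#[short(type="loGroupType")]
HB.structure Definition LinearlyOrderedGroup (d : Order.disp_t) :=
  {G of Group G & Order.Total d G & isLinearlyOrderedGroup d G}.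

Definition positive_cone {d} (G : loGroupType d) : set G :=
  [set x | 1 <= x].
Arguments positive_cone {d} G.

Definition d_group {d} (G : loGroupType d) : Prop :=
  forall g, positive_cone G g -> g <> 1 ->
    exists x, [/\ positive_cone G x, x <> 1 & x < g].

(* Subsets T of an ambient semigroup M, seen as semigroups in their own right:
   every notion below is relative to T and not to M. *)
Section SemigroupNotions.
Variable M : semigroupType.
Implicit Types (T E : set M) (a b c : M).

Definition subsemigroup T : Prop :=
  forall a b, T a -> T b -> T (a * b).

Definition idempotents T : set M := [set e | T e /\ e * e = e].

Definition natural_le a b : Prop := a * b = a /\ b * a = a.

Definition semilattice E : Prop :=
  [/\ subsemigroup E, forall e, E e -> e * e = e &
      forall e f, E e -> E f -> e * f = f * e].

Definition linear_semilattice E : Prop :=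
  semilattice E /\
  forall e f, E e -> E f -> natural_le e f \/ natural_le f e.

Definition inverse_semigroup T : Prop :=
  subsemigroup T /\
  forall a, T a -> exists! b, [/\ T b, a * b * a = a & b * a * b = b].

Definition has_identity T : Prop :=
  exists2 u, T u & forall a, T a -> u * a = a /\ a * u = a.

(* T^1 lives in [option M], where [None] is the adjoined identity. *)
Definition adjoin1 T : set (option M) :=
  [set Some a | a in T] `|` [set u | u = None /\ ~ has_identity T].

Definition mul1 (u v : option M) : option M :=
  match u, v with
  | Some a, Some b => Some (a * b)
  | None, _ => v
  | _, None => u
  end.

Definition right_ideal T a : set (option M) :=
  [set mul1 (Some a) u | u in adjoin1 T].
Definition left_ideal T a : set (option M) :=
  [set mul1 u (Some a) | u in adjoin1 T].
Definition two_sided_ideal T a : set (option M) :=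
  [set mul1 (mul1 u (Some a)) v | u in adjoin1 T & v in adjoin1 T].

Definition greenR T a b : Prop := right_ideal T a = right_ideal T b.
Definition greenL T a b : Prop := left_ideal T a = left_ideal T b.
Definition greenH T a b : Prop := greenL T a b /\ greenR T a b.
Definition greenD T a b : Prop :=
  exists c, [/\ T c, greenL T a c & greenR T c b].

Definition green_class (r : M -> M -> Prop) T a : set M :=
  [set b | T b /\ r a b].

Definition D_classes T : set (set M) :=
  [set green_class (greenD T) T a | a in T].

Definition simple_semigroup T : Prop :=
  subsemigroup T /\
  forall a b, T a -> T b -> two_sided_ideal T a = two_sided_ideal T b.

End SemigroupNotions.

(* [None] means undefined. *)
Definition partial_map (X : choiceType) : Type := X -> option X.

HB.instance Definition _ (X : choiceType) := Choice.on (partial_map X).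

(* Maps act on the right: [f * g] is [f] followed by [g]. *)
Definition partial_map_mul (X : choiceType) (f g : partial_map X) : partial_map X := pcomp g f.

Fact partial_map_mulA (X : choiceType) : associative (@partial_map_mul X).
Proof.
move=> f g h; apply/funext => x; rewrite /partial_map_mul /pcomp.
by case: (f x).
Qed.

HB.instance Definition _ (X : choiceType) :=
  isSemigroup.Build (partial_map X) (@partial_map_mulA X).

Section Extensions.
Context {d : Order.disp_t} {G : loGroupType d}.
Implicit Types (g h : G) (P : set G).

Definition alpha g h : partial_map G :=
  fun x => if g <= x then Some (x * g^-1 * h) else None.
Definition oalpha g h : partial_map G :=
  fun x => if g < x then Some (x * g^-1 * h) else None.

Definition alphas P : set (partial_map G) := [set alpha g h | g in P & h in P].
Definition oalphas P : set (partial_map G) := [set oalpha g h | g in P & h in P].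

End Extensions.

Section Semigroups.
Context {d : Order.disp_t} (G : loGroupType d).

Definition B : set (partial_map G) := alphas [set: G].
Definition oB : set (partial_map G) := oalphas [set: G].
Definition Bbar : set (partial_map G) := oB `|` B.

Definition Bplus : set (partial_map G) := alphas (positive_cone G).
Definition oBplus : set (partial_map G) := oalphas (positive_cone G).
Definition Bbarplus : set (partial_map G) := oBplus `|` Bplus.

End Semigroups.

Arguments B {d} G.
Arguments oB {d} G.
Arguments Bbar {d} G.
Arguments Bplus {d} G.
Arguments oBplus {d} G.
Arguments Bbarplus {d} G.

(* The natural order of (P, max) is the dual of the order of G, hence [G^d];
   [bool] carries false < true, with minimum [andb]. *)
Definition lex01 {d} (G : loGroupType d) := (G^d *l bool)%type.

(* Main.v *)
Require Import Defs.
From mathcomp Require Import all_boot all_order.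
From mathcomp Require Import boolp classical_sets functions.

(* Let c be true or false according as a translation with domain bounded below
   by g is closed or open, and write [c; g, h] for it. Then [b; g, h] [c; k, l]
   is [b; g, h k^-1 l] if h > k, [c; k h^-1 g, l] if h < k, and
   [b and c; g, l] if h = k; this only needs P to be upward closed. Density
   makes the triple (c, g, h) unique. Hence [c; h, g] is an inverse of
   [c; g, h], the idempotents are the [c; g, g], and Green's relations R and L
   amount to equality of the idempotents a a^-1 and a^-1 a respectively. *)

Set Implicit Arguments.
Unset Strict Implicit.
Unset Printing Implicit Defensive.

Import Order.TTheory.

Local Open Scope order_scope.
Local Open Scope group_scope.
Local Open Scope classical_set_scope.

(** * Green's relations and inverses for regular elements of a subsemigroup *)

Section RegularElements.
Context {M : semigroupType} {T : set M} (Tmul : subsemigroup T).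
Implicit Types (a b e f t x y : M) (u v : option M).

Lemma mul1A : associative (@mul1 M).
Proof. by move=> [a|] [b|] [c|] //=; rewrite mulgA. Qed.

Lemma adjoin1_mem t : T t -> adjoin1 T (Some t).
Proof. by move=> Tt; left; exists t. Qed.

(** A product with a factor in [T] stays in [T], so it never has to be decided whether an identity
    was adjoined. *)
Lemma adjoin1_mull t u : T t -> adjoin1 T u -> adjoin1 T (mul1 (Some t) u).
Proof.
move=> Tt [[a Ta <-]|[-> _]]; apply: adjoin1_mem => //; exact: Tmul.
Qed.

Lemma adjoin1_mulr t u : T t -> adjoin1 T u -> adjoin1 T (mul1 u (Some t)).
Proof.
move=> Tt [[a Ta <-]|[-> _]]; apply: adjoin1_mem => //; exact: Tmul.
Qed.

Lemma right_idealS a b t :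
  T t -> a = b * t -> right_ideal T a `<=` right_ideal T b.
Proof.
move=> Tt -> _ [u Tu <-]; exists (mul1 (Some t) u); first exact: adjoin1_mull.
by rewrite mul1A.
Qed.

Lemma left_idealS a b t :
  T t -> a = t * b -> left_ideal T a `<=` left_ideal T b.
Proof.
move=> Tt -> _ [u Tu <-]; exists (mul1 u (Some t)); first exact: adjoin1_mulr.
by rewrite -mul1A.
Qed.

Lemma two_sided_idealS a b x y :
  T x -> T y -> a = x * b * y -> two_sided_ideal T a `<=` two_sided_ideal T b.
Proof.
move=> Tx Ty -> _ [u Tu [v Tv <-]].
exists (mul1 u (Some x)); first exact: adjoin1_mulr.
exists (mul1 (Some y) v); first exact: adjoin1_mull.
by case: u {Tu} => [u|]; case: v {Tv} => [v|] /=; rewrite ?mulgA.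
Qed.

Lemma mem_right_idealP a b :
  T a -> right_ideal T b (Some a) -> a = b \/ exists2 t, T t & a = b * t.
Proof.
move=> Ta [_ [[t Tt <-]|[-> _]]] [<-]; [by right; exists t|by left].
Qed.

Lemma mem_left_idealP a b :
  T a -> left_ideal T b (Some a) -> a = b \/ exists2 t, T t & a = t * b.
Proof.
move=> Ta [_ [[t Tt <-]|[-> _]]] [<-]; [by right; exists t|by left].
Qed.

(** Since [a = a * a' * a], the elements [a] and [a * a'] generate the same right ideal; that of [a]
    is contained in that of [b] exactly when [b * b'] fixes [a * a'] from the left. *)
Lemma greenR_regular a a' b b' :
    T a -> T a' -> T b -> T b' -> a * a' * a = a -> b * b' * b = b ->
  greenR T a b <->
  b * b' * (a * a') = a * a' /\ a * a' * (b * b') = b * b'.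
Proof.
have half x x' y y' : T x -> T x' -> x * x' * x = x -> y * y' * y = y ->
    right_ideal T x `<=` right_ideal T y -> y * y' * (x * x') = x * x'.
  move=> Tx Tx' xx'x yy'y /(_ (Some x)) xy.
  have xTx : right_ideal T x (Some x).
    exists (Some (x' * x)); first by apply/adjoin1_mem/Tmul.
    by rewrite /= mulgA xx'x.
  case: (mem_right_idealP Tx (xy xTx)) => [->|[t Tt ->]];
    by rewrite !mulgA yy'y.
move=> Ta Ta' Tb Tb' aa'a bb'b; split=> [ab|[ba ab]].
  split; first by apply: half aa'a bb'b _ => //; rewrite -ab.
  by apply: half bb'b aa'a _ => //; rewrite ab.
apply/seteqP; split.
  (* The witness comes from a = a a' a = b b' a a' a = b (b' a). *)
  apply: (@right_idealS _ _ (b' * a)); first exact: Tmul.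
  by rewrite -{1}aa'a -ba -!mulgA (mulgA a) aa'a.
apply: (@right_idealS _ _ (a' * b)); first exact: Tmul.
by rewrite -{1}bb'b -ab -!mulgA (mulgA b) bb'b.
Qed.

Lemma greenL_regular a a' b b' :
    T a -> T a' -> T b -> T b' -> a * a' * a = a -> b * b' * b = b ->
  greenL T a b <->
  a' * a * (b' * b) = a' * a /\ b' * b * (a' * a) = b' * b.
Proof.
have half x x' y y' : T x -> T x' -> x * x' * x = x -> y * y' * y = y ->
    left_ideal T x `<=` left_ideal T y -> x' * x * (y' * y) = x' * x.
  move=> Tx Tx' xx'x yy'y /(_ (Some x)) xy.
  have xTx : left_ideal T x (Some x).
    by exists (Some (x * x')); [apply/adjoin1_mem/Tmul|rewrite /= xx'x].
  case: (mem_left_idealP Tx (xy xTx)) => [->|[t Tt ->]];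
    by rewrite -!mulgA (mulgA y) yy'y.
move=> Ta Ta' Tb Tb' aa'a bb'b; split=> [ab|[ba ab]].
  split; first by apply: half aa'a bb'b _ => //; rewrite -ab.
  by apply: half bb'b aa'a _ => //; rewrite ab.
apply/seteqP; split.
  apply: (@left_idealS _ _ (a * b')); first exact: Tmul.
  by rewrite -[LHS]aa'a -mulgA -ba !mulgA aa'a.
apply: (@left_idealS _ _ (b * a')); first exact: Tmul.
by rewrite -[LHS]bb'b -mulgA -ab !mulgA bb'b.
Qed.

(** Regularity gives existence of inverses, and commuting idempotents give uniqueness. *)
Lemma inverse_semigroup_regular :
    (forall a, T a -> exists b, [/\ T b, a * b * a = a & b * a * b = b]) ->
    (forall e f, idempotents T e -> idempotents T f -> e * f = f * e) ->
  inverse_semigroup T.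
Proof.
move=> reg comm; split=> // a Ta; have [x [Tx axa xax]] := reg a Ta.
exists x; split=> // y [Ty aya yay].
have idl z : T z -> a * z * a = a -> idempotents T (z * a).
  by move=> Tz aza; split; [exact: Tmul|rewrite -mulgA (mulgA a) aza].
have idr z : T z -> a * z * a = a -> idempotents T (a * z).
  by move=> Tz aza; split; [exact: Tmul|rewrite mulgA aza].
(* Both inverses reduce to [y * a * x]: the first by commuting [x * a] with [y * a], the second by
   commuting [a * x] with [a * y]. *)
have xE : x = x * a * (y * a) * x by rewrite -(mulgA x) (mulgA a) aya xax.
have yE : y = y * (a * x * (a * y)) by rewrite (mulgA (a * x)) axa mulgA yay.
rewrite xE (comm _ _ (idl x Tx axa) (idl y Ty aya)) -mulgA xax.
by rewrite [in RHS]yE (comm _ _ (idr x Tx axa) (idr y Ty aya)) !mulgA yay.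
Qed.

End RegularElements.

(** * Strict monotonicity of translations, and density *)

Section OrderedGroup.
Context {d : Order.disp_t} {G : loGroupType d}.
Implicit Types (g h k l x : G).

Lemma leMg2r_mono k : {mono *%g^~ k : g h / g <= h}.
Proof.
move=> g h; apply/idP/idP => [|gh]; last exact: leMg2r.
by move/(leMg2r k^-1); rewrite !mulgK.
Qed.

Lemma ltMg2r k : {mono *%g^~ k : g h / g < h}.
Proof. exact: leW_mono (leMg2r_mono k). Qed.

(** The d-group property puts a point strictly between 1 and [h * g^-1]; right translation by [g]
    carries it between [g] and [h]. *)
Lemma d_group_dense g h : d_group G -> g < h -> exists2 x, g < x & x < h.
Proof.
move=> dG gh.
have gt1 : 1 < h * g^-1 by rewrite -(mulgV g) ltMg2r.
have [||x [x0 x1 xlt]] := dG (h * g^-1); first exact: ltW.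
  by move=> eq1; rewrite eq1 ltxx in gt1.
exists (x * g).
  by rewrite -[ltLHS]mul1g ltMg2r lt_neqAle x0 andbT eq_sym; apply/eqP.
by rewrite -[ltRHS](mulgVK g) ltMg2r.
Qed.

End OrderedGroup.

(** * Closed and open translations, and their product formula *)

Section Shifts.
Context {d : Order.disp_t} {G : loGroupType d}.
Implicit Types (b c : bool) (g h k l x : G) (P : set G).

(* [true] selects the closed objects and [false] the open ones. *)
Definition ray c g x := if c then g <= x else g < x.

Definition shift c g h : partial_map G := if c then alpha g h else oalpha g h.

Lemma shiftE c g h x :
  shift c g h x = if ray c g x then Some (x * g^-1 * h) else None.
Proof. by case: c. Qed.

(** The preimage of a ray under a translation is a ray of the same kind. *)
Lemma rayM c k h g x : ray c k (x * g^-1 * h) = ray c (k * h^-1 * g) x.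
Proof.
rewrite /ray -[k <= _](leMg2r_mono (h^-1 * g)) -[k < _](ltMg2r (h^-1 * g)).
by rewrite !mulgA mulgK mulgVK.
Qed.

Lemma shiftM b c g h k l :
  shift b g h * shift c k l =
  if k < h then shift b g (h * k^-1 * l)
  else if h < k then shift c (k * h^-1 * g) l
  else shift (b && c) g l.
Proof.
apply/funext => x.
(* The composite lives on the intersection of two rays, whose endpoints [g] and [k * h^-1 * g]
   compare as [h] and [k] do; the larger endpoint decides. *)
have -> : (shift b g h * shift c k l) x =
    if ray b g x && ray c (k * h^-1 * g) x
    then Some (x * g^-1 * h * k^-1 * l) else None.
  rewrite /mul /= /partial_map_mul /pcomp /= shiftE; case: ifP => //= _.
  by rewrite shiftE rayM.
have cut : (k * h^-1 * g < g) = (k < h).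
  by rewrite -[X in _ < X]mul1g ltMg2r -(mulgV h) ltMg2r.
have cut' : (g < k * h^-1 * g) = (h < k).
  by rewrite -[X in X < _]mul1g ltMg2r -(mulgV h) ltMg2r.
case: (ltgtP k h) cut cut' => [kh cut _|hk _ cut|-> _ _]; rewrite shiftE.
- have -> : ray b g x && ray c (k * h^-1 * g) x = ray b g x.
    rewrite andb_idr // /ray; case: b; case: c => // xx.
    + exact: le_trans (ltW cut) xx.
    + exact: lt_le_trans cut xx.
    + exact: le_trans (ltW cut) (ltW xx).
    + exact: lt_trans cut xx.
  by rewrite !mulgA.
- have -> : ray b g x && ray c (k * h^-1 * g) x = ray c (k * h^-1 * g) x.
    rewrite andb_idl // /ray; case: b; case: c => // xx.
    + exact: le_trans (ltW cut) xx.
    + exact: le_trans (ltW cut) (ltW xx).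
    + exact: lt_le_trans cut xx.
    + exact: lt_trans cut xx.
  by rewrite !invgM invgK !mulgA.
(* With a common endpoint the intersection is closed only if both rays are. *)
rewrite mulgV mul1g mulgK; congr (if _ then _ else _).
by rewrite /ray; case: b; case: c; rewrite ?andbb //=; case: ltgtP.
Qed.

Lemma shift_inverse c g h : shift c g h * shift c h g = shift c g g.
Proof. by rewrite shiftM ltxx andbb. Qed.

Lemma shift_regular c g h : shift c g h * shift c h g * shift c g h = shift c g h.
Proof. by rewrite shift_inverse shiftM ltxx andbb. Qed.

Lemma shift_idemM b c g k :
  shift b g g * shift c k k =
  if k < g then shift b g g else if g < k then shift c k k else shift (b && c) g g.
Proof. by rewrite shiftM !mulgVK; case: (ltgtP k g) => [||->]. Qed.

Lemma shift_idemC b c g k :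
  shift b g g * shift c k k = shift c k k * shift b g g.
Proof. by rewrite !shift_idemM andbC; case: ltgtP => // ->. Qed.

(** * Uniqueness of the parameters, and the order of idempotents, in a d-group *)

Section DGroup.
Hypothesis dG : d_group G.

Lemma ray_subset b c g k : (forall x, ray b g x -> ray c k x) ->
  (k < g) || ((k == g) && (b ==> c)).
Proof.
move=> sub; case: ltgtP => [//|gk|kg] /=.
  case: b sub => sub.
    have := sub g (lexx g); rewrite /ray.
    by case: c {sub}; rewrite ?leNgt ?gk // ltNge (ltW gk).
  (* An open ray lacks its endpoint, so density must supply a point of it below [k]. *)
  have [x gx xk] := d_group_dense dG gk.
  have := sub x gx; rewrite /ray.
  by case: c {sub}; rewrite ?leNgt ?xk // ltNge (ltW xk).
by case: b c sub => [] [] // /(_ g (lexx g)); rewrite /ray kg ltxx.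
Qed.

Lemma shift_inj b c g h k l :
  shift b g h = shift c k l -> [/\ b = c, g = k & h = l].
Proof.
move=> eqs.
have eqr x : ray b g x = ray c k x.
  by have := congr1 (@^~ x) eqs; rewrite /= !shiftE; do 2?case: ifP.
have [eb eg] : b = c /\ g = k.
  have := @ray_subset b c g k; have := @ray_subset c b k g.
  move=> /(_ (fun x xk => etrans (eqr x) xk)).
  move=> s1 /(_ (fun x xg => etrans (esym (eqr x)) xg)).
  by case: ltgtP s1 => //= ->; case: b c {eqs eqr} => [] [].
split=> //; subst c k.
have eqv x : g < x -> h = l.
  move=> gx; have := congr1 (@^~ x) eqs; rewrite /= !shiftE.
  have -> : ray b g x by rewrite /ray gx (ltW gx) if_same.
  by move=> [/mulgI].
(* Comparing values requires a point above [g]. If [h] and [l] differ, the quotient of the larger by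
   the smaller yields one, so the trivial group is covered too. *)
have gtM p q : q < p -> g < p * q^-1 * g.
  by move=> qp; rewrite -[ltLHS]mul1g ltMg2r -(mulgV q) ltMg2r.
by case: (ltgtP h l) => // /gtM /eqv.
Qed.

Lemma shift_idempotentP c g h :
  shift c g h * shift c g h = shift c g h <-> g = h.
Proof.
split=> [|->]; last by rewrite shift_inverse.
rewrite shiftM; case: ltgtP => // _ /shift_inj[_].
  by move=> _; rewrite -[RHS]mulg1 -mulgA => /mulgI/mulg1_eq; rewrite invgK.
by rewrite -[RHS]mul1g => /mulIg/divg1_eq.
Qed.

(** Idempotent shifts are restrictions of the identity, so their natural order is inclusion of rays,
    with the criterion of [ray_subset]. *)
Lemma natural_le_shift b c g k :
  natural_le (shift b g g) (shift c k k) <-> k < g \/ k = g /\ b ==> c.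
Proof.
rewrite /natural_le (shift_idemC c) shift_idemM.
case: ltgtP => [kg|gk|->]; first by split=> // _; left.
  split=> [[/shift_inj[_ kg]]|[//|[kg]]]; by rewrite kg ltxx in gk.
split=> [[/shift_inj[bcb _ _] _]|[//|[_ bc]]].
  by right; split=> //; case: b bcb => //=.
by rewrite (andb_idr (implyP bc)).
Qed.

(* The default [(1, true)] is returned off the diagonal shifts. *)
Definition lex_code (f : partial_map G) : lex01 G :=
  xget (1, true) [set p : G * bool | f = shift p.2 p.1 p.1].

Lemma lex_code_shift c g : lex_code (shift c g g) = (g, c).
Proof.
apply: xget_unique => //= -[k b] /= /shift_inj[-> -> _] //.
Qed.

End DGroup.

(** The boolean index lets one argument serve both kinds; the two instances are convertible to
    [alphas P] and [oalphas P]. *)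
Definition shifts c P : set (partial_map G) :=
  [set shift c g h | g in P & h in P].

Definition all_shifts P := oalphas P `|` alphas P.

Lemma all_shiftsP P f :
  all_shifts P f <-> exists c, shifts c P f.
Proof.
split=> [[]|[[] ?]]; first by exists false.
- by exists true.
- by right.
- by left.
Qed.

Lemma all_shifts_mem P c g h : P g -> P h -> all_shifts P (shift c g h).
Proof. by move=> Pg Ph; apply/all_shiftsP; exists c, g => //; exists h. Qed.

(** * Shifts over an upward closed index set *)

Section UpwardClosed.
Hypothesis dG : d_group G.
Variable P : set G.
Hypothesis P_up : forall g x, P g -> g <= x -> P x.

Lemma shifts_mul b c f f' : shifts b P f -> shifts c P f' ->
  shifts b P (f * f') \/ shifts c P (f * f').
Proof.
move=> [g Pg [h Ph <-]] [k Pk [l Pl <-]]; rewrite shiftM.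
(* The index altered by the product formula has this form, hence lies above the index [r] that it
   replaces. *)
have up p q r : P r -> q < p -> P (p * q^-1 * r).
  move=> Pr qp; apply: P_up Pr _; apply: ltW.
  by rewrite -[ltLHS]mul1g ltMg2r -(mulgV q) ltMg2r.
case: ltgtP => [kh|hk|_].
- by left; exists g => //; exists (h * k^-1 * l) => //; exact: up.
- by right; exists (k * h^-1 * g); [exact: up|exists l].
- by case: b => /=; [right|left]; exists g => //; exists l.
Qed.

Lemma shifts_subsemigroup c : subsemigroup (shifts c P).
Proof. by move=> f f' Sf Sf'; case: (shifts_mul Sf Sf'). Qed.

Lemma all_shifts_subsemigroup : subsemigroup (all_shifts P).
Proof.
move=> f f' /all_shiftsP[b Sf] /all_shiftsP[c Sf']; apply/all_shiftsP.
by case: (shifts_mul Sf Sf'); [exists b|exists c].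
Qed.

(** * Idempotents and their lexicographic coding *)

Lemma idempotents_shifts c : idempotents (shifts c P) = [set shift c g g | g in P].
Proof.
apply/seteqP; split=> [_ [[g Pg [h Ph <-]] /(shift_idempotentP dG) <-]|].
  by exists g.
by move=> _ [g Pg <-]; split; [exists g => //; exists g|exact: shift_inverse].
Qed.

Lemma idempotents_all_shifts :
  idempotents (all_shifts P) =
  idempotents (alphas P) `|` idempotents (oalphas P).
Proof. by apply/seteqP; split=> f; rewrite /idempotents /all_shifts /=; tauto. Qed.

Lemma idempotents_all_shiftsP e :
  idempotents (all_shifts P) e <-> exists c, exists2 g, P g & e = shift c g g.
Proof.
rewrite idempotents_all_shifts -[alphas P]/(shifts true P).
rewrite -[oalphas P]/(shifts false P) !idempotents_shifts; split.
  by move=> [] [g Pg <-]; [exists true, g|exists false, g].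
by move=> [[] [g Pg ->]]; [left|right]; exists g.
Qed.

Lemma idempotents_linear : linear_semilattice (idempotents (all_shifts P)).
Proof.
split; first split.
- move=> e f /idempotents_all_shiftsP[b [g Pg ->]].
  move=> /idempotents_all_shiftsP[c [k Pk ->]]; rewrite shift_idemM.
  apply/idempotents_all_shiftsP.
  by case: ltgtP => _; [exists b, g|exists c, k|exists (b && c), g].
- by move=> e [].
- move=> e f /idempotents_all_shiftsP[b [g Pg ->]].
  by move=> /idempotents_all_shiftsP[c [k Pk ->]]; exact: shift_idemC.
move=> e f /idempotents_all_shiftsP[b [g Pg ->]].
move=> /idempotents_all_shiftsP[c [k Pk ->]].
rewrite !natural_le_shift //.
case: (ltgtP g k) => [gk|kg|->]; [by right; left|by left; left|].
by case: b; [right|left]; right; rewrite ?implybT.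
Qed.

Lemma lex_code_bij :
  set_bij (idempotents (all_shifts P)) (P `*` [set: bool]) lex_code.
Proof.
split.
- move=> e /idempotents_all_shiftsP[c [g Pg ->]].
  by rewrite lex_code_shift.
- move=> e f; rewrite !inE => /idempotents_all_shiftsP[b [g _ ->]].
  move=> /idempotents_all_shiftsP[c [k _ ->]].
  by rewrite !lex_code_shift // => -[-> ->].
move=> [g c] /= [Pg _]; exists (shift c g g); last exact: lex_code_shift.
by apply/idempotents_all_shiftsP; exists c, g.
Qed.

Lemma lex_code_min e f :
    idempotents (all_shifts P) e -> idempotents (all_shifts P) f ->
  lex_code (e * f) = Order.min (lex_code e) (lex_code f).
Proof.
move=> /idempotents_all_shiftsP[b [g Pg ->]].
move=> /idempotents_all_shiftsP[c [k Pk ->]].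
have -> : lex_code (shift b g g * shift c k k) =
    if k < g then (g, b) else if g < k then (k, c) else (g, b && c).
  by rewrite shift_idemM; case: ltgtP => _; exact: lex_code_shift.
rewrite !lex_code_shift // minEle.
(* As the first factor carries the reversed order, this is the criterion of [natural_le_shift]. *)
have -> : ((g, b) <= (k, c) :> lex01 G) = (k < g) || ((k == g) && (b ==> c)).
  rewrite Order.ProdLexiOrder.lexi_pair.
  rewrite -[(g <= k :> G^d)]/(k <= g) -[(k <= g :> G^d)]/(g <= k).
  by case: ltgtP => //= _; case: b; case: c.
by case: ltgtP => //= ->; case: b; case: c.
Qed.

(** * Green's relations on the union of both kinds *)

Lemma greenR_shift b c g h k l : P g -> P h -> P k -> P l ->
  greenR (all_shifts P) (shift b g h) (shift c k l) <-> b = c /\ g = k.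
Proof.
move=> Pg Ph Pk Pl.
rewrite (@greenR_regular _ _ all_shifts_subsemigroup _ (shift b h g) _ (shift c l k));
  do ?[exact: all_shifts_mem | exact: shift_regular].
rewrite !shift_inverse; split=> [[ba ab]|[-> ->]]; last by rewrite shift_inverse.
(* Commuting idempotents that absorb each other coincide, and their parameters can be read off. *)
by rewrite shift_idemC ab in ba; case: (shift_inj dG ba).
Qed.

Lemma greenL_shift b c g h k l : P g -> P h -> P k -> P l ->
  greenL (all_shifts P) (shift b g h) (shift c k l) <-> b = c /\ h = l.
Proof.
move=> Pg Ph Pk Pl.
rewrite (@greenL_regular _ _ all_shifts_subsemigroup _ (shift b h g) _ (shift c l k));
  do ?[exact: all_shifts_mem | exact: shift_regular].
rewrite !shift_inverse; split=> [[ba ab]|[-> ->]]; last by rewrite shift_inverse.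
by rewrite shift_idemC ba in ab; case: (shift_inj dG ab).
Qed.

Lemma greenH_shift b c g h k l : P g -> P h -> P k -> P l ->
  greenH (all_shifts P) (shift b g h) (shift c k l) <-> [/\ b = c, g = k & h = l].
Proof.
move=> Pg Ph Pk Pl; rewrite /greenH greenR_shift // greenL_shift //.
by split=> [[[-> ->] [_ ->]]|[-> -> ->]].
Qed.

Lemma greenD_shift b c g h k l : P g -> P h -> P k -> P l ->
  greenD (all_shifts P) (shift b g h) (shift c k l) <-> b = c.
Proof.
move=> Pg Ph Pk Pl; split=> [[f [/all_shiftsP[a [x Px [y Py <-]]]]]|<-].
  by move=> /(greenL_shift _ _ Pg Ph Px Py)[-> _] /(greenR_shift _ _ Px Py Pk Pl)[].
(* The witness takes its second index from the first element and its first index from the second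
   element. *)
exists (shift b k h); split; first exact: all_shifts_mem.
  exact/greenL_shift.
exact/greenR_shift.
Qed.

Lemma green_class_greenD_shift c f :
  shifts c P f -> green_class (greenD (all_shifts P)) (all_shifts P) f = shifts c P.
Proof.
move=> [g Pg [h Ph <-]]; apply/seteqP; split=> f'.
  move=> [/all_shiftsP[b [k Pk [l Pl <-]]]] /(greenD_shift _ _ Pg Ph Pk Pl) ->.
  by exists k => //; exists l.
move=> Sf'; split; first by apply/all_shiftsP; exists c.
by case: Sf' => [k Pk [l Pl <-]]; exact/greenD_shift.
Qed.

(** * Inverse subsemigroups and simplicity *)

Lemma shifts_inverse_semigroup c : inverse_semigroup (shifts c P).
Proof.
apply: inverse_semigroup_regular (@shifts_subsemigroup c) _ _.
  move=> _ [g Pg [h Ph <-]]; exists (shift c h g).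
  split; [|exact: shift_regular..].
  by exists h => //; exists g.
move=> e f; rewrite idempotents_shifts => -[g _ <-] [k _ <-].
exact: shift_idemC.
Qed.

(* With [m > g], the element [shift c k m * shift b g g * shift c m k] is the
   idempotent [shift c k k], whatever [b] and [c] are. *)
Lemma all_shifts_simple :
  (exists g : G, g <> 1) -> simple_semigroup (all_shifts P).
Proof.
move=> [p0 p0_neq1].
have [p p_gt1] : exists p : G, 1 < p.
  case: (ltgtP 1 p0) => [||eq1]; first by exists p0.
    by exists p0^-1; rewrite -(mulgV p0) -[ltRHS]mul1g ltMg2r.
  by rewrite eq1 in p0_neq1.
split; first exact: all_shifts_subsemigroup.
suff sub f f' : all_shifts P f -> all_shifts P f' ->
    two_sided_ideal (all_shifts P) f `<=` two_sided_ideal (all_shifts P) f'.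
  by move=> f f' Tf Tf'; apply/seteqP; split; exact: sub.
move=> /all_shiftsP[c [k Pk [l Pl <-]]] /all_shiftsP[b [g Pg [h Ph <-]]].
have gm : g < p * g by rewrite -[ltLHS]mul1g ltMg2r.
have Pm : P (p * g) by apply: P_up Pg (ltW gm).
apply: (@two_sided_idealS _ _ all_shifts_subsemigroup _ _
    (shift c k (p * g)) (shift b h g * shift c (p * g) l)).
- exact: all_shifts_mem.
- by apply: all_shifts_subsemigroup; exact: all_shifts_mem.
(* The factor [shift b h g] turns the middle element into [shift b g g], which [shift c k (p * g)]
   absorbs because [g < p * g]; the last factor restores the index [l]. *)
rewrite -mulgA (mulgA (shift b g h)) shift_inverse mulgA.
by rewrite shiftM gm mulgVK shiftM ltxx andbb.
Qed.

End UpwardClosed.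
End Shifts.

Theorem proposition2p2 (d : Order.disp_t) (G : loGroupType d)
    (Sbar S oS : set (partial_map G)) (P : set G)
    (hG : d_group G)
    (hS : (Sbar, S, oS, P) = (Bbar G, B G, oB G, [set: G]) \/
          (Sbar, S, oS, P) =
            (Bbarplus G, Bplus G, oBplus G, positive_cone G)) :
  (* (i) *)
  idempotents Sbar = idempotents S `|` idempotents oS /\
  (* (ii) *)
  (forall g, P g ->
     idempotents Sbar (alpha g g) /\ idempotents Sbar (oalpha g g)) /\
  (forall g h, P g -> P h ->
     [/\ natural_le (alpha g g) (alpha h h) <-> h <= g,
         natural_le (oalpha g g) (oalpha h h) <-> h <= g,
         natural_le (alpha g g) (oalpha h h) <-> h < g &
         natural_le (oalpha g g) (alpha h h) <-> h <= g]) /\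
  (* (iii) *)
  (exists i : partial_map G -> lex01 G,
     [/\ forall g, P g -> i (alpha g g) = (g, true),
         forall g, P g -> i (oalpha g g) = (g, false),
         set_bij (idempotents Sbar) (P `*` [set: bool]) i &
         forall e f, idempotents Sbar e -> idempotents Sbar f ->
           i (e * f) = Order.min (i e) (i f)]) /\
  linear_semilattice (idempotents Sbar) /\
  (* (iv) *)
  ((forall a b, Sbar a -> Sbar b -> greenR Sbar a b ->
      (S a /\ S b) \/ (oS a /\ oS b)) /\
   (forall g h k l, P g -> P h -> P k -> P l ->
      (greenR Sbar (alpha g h) (alpha k l) <-> g = k) /\
      (greenR Sbar (oalpha g h) (oalpha k l) <-> g = k))) /\
  (* (v) *)
  ((forall a b, Sbar a -> Sbar b -> greenL Sbar a b ->
      (S a /\ S b) \/ (oS a /\ oS b)) /\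
   (forall g h k l, P g -> P h -> P k -> P l ->
      (greenL Sbar (alpha g h) (alpha k l) <-> h = l) /\
      (greenL Sbar (oalpha g h) (oalpha k l) <-> h = l))) /\
  (* (vi) *)
  ((forall a b, Sbar a -> Sbar b -> greenH Sbar a b ->
      (S a /\ S b) \/ (oS a /\ oS b)) /\
   (forall g h k l, P g -> P h -> P k -> P l ->
      (greenH Sbar (alpha g h) (alpha k l) <-> g = k /\ h = l) /\
      (greenH Sbar (oalpha g h) (oalpha k l) <-> g = k /\ h = l)) /\
   (forall a, Sbar a -> green_class (greenH Sbar) Sbar a = [set a])) /\
  (* (vii) *)
  ((exists g : G, g <> 1) -> simple_semigroup Sbar) /\
  (* (viii) *)
  [/\ D_classes Sbar = [set S; oS], S <> oS,
      inverse_semigroup S & inverse_semigroup oS].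
Proof.
(* Both cases are reduced to an upward closed [P] containing 1, and are not distinguished
   afterwards. *)
have [P_up [P1 [-> [-> ->]]]] : (forall g x, P g -> g <= x -> P x) /\ P 1 /\
    Sbar = all_shifts P /\ S = shifts true P /\ oS = shifts false P.
  case: hS => -[-> -> -> ->]; split=> //; last by split=> //; exact: lexx.
  by move=> g x; exact: le_trans.
(* This serves the relations R, L and H alike. *)
have same_kind (r : partial_map G -> partial_map G -> Prop) :
    (forall b c g h k l, P g -> P h -> P k -> P l ->
       r (shift b g h) (shift c k l) -> b = c) ->
    forall a b, all_shifts P a -> all_shifts P b -> r a b ->
      shifts true P a /\ shifts true P b \/ shifts false P a /\ shifts false P b.
  move=> rE _ _ /all_shiftsP[b [g Pg [h Ph <-]]] /all_shiftsP[c [k Pk [l Pl <-]]].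
  move=> /rE -> //.
  have Sg : shifts c P (shift c g h) by exists g => //; exists h.
  have Sk : shifts c P (shift c k l) by exists k => //; exists l.
  by case: c Sg Sk; [left|right].
split; first exact: idempotents_all_shifts.
split.
  move=> g Pg; split; apply/(idempotents_all_shiftsP hG).
    by exists true, g.
  by exists false, g.
split.
  move=> g h _ _; have E b c := natural_le_shift hG b c g h.
  have leE : h < g \/ h = g /\ true <-> h <= g.
    rewrite le_eqVlt; split=> [[->|[->]]|/predU1P[->|]]; rewrite ?eqxx ?orbT //.
      by right.
    by left.
  split; [exact: iff_trans (E true true) leE|exact: iff_trans (E false false) leE
    | |exact: iff_trans (E false true) leE].
  (* A closed ray is not contained in the open ray with the same endpoint, so only the strict
     alternative survives. *)
  by apply: iff_trans (E true false) _; split=> [[|[]]|]; last left.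
split.
  exists lex_code; split.
  - by move=> g _; exact: (lex_code_shift hG true).
  - by move=> g _; exact: (lex_code_shift hG false).
  - exact: lex_code_bij.
  - exact: lex_code_min.
split; first exact: idempotents_linear.
split; last split; last split; last split.
- split; first by apply: same_kind => b c g h k l ? ? ? ? /greenR_shift[].
  move=> g h k l Pg Ph Pk Pl.
  rewrite -![alpha _ _]/(shift true _ _) -![oalpha _ _]/(shift false _ _).
  by rewrite !greenR_shift //; split; split=> [[]|].
- split; first by apply: same_kind => b c g h k l ? ? ? ? /greenL_shift[].
  move=> g h k l Pg Ph Pk Pl.
  rewrite -![alpha _ _]/(shift true _ _) -![oalpha _ _]/(shift false _ _).
  by rewrite !greenL_shift //; split; split=> [[]|].
- split; first by apply: same_kind => b c g h k l ? ? ? ? /greenH_shift[].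
  split=> [g h k l Pg Ph Pk Pl|a].
    rewrite -![alpha _ _]/(shift true _ _) -![oalpha _ _]/(shift false _ _).
    by rewrite !greenH_shift //; split; split=> [[]|[]].
  move=> Ta; apply/seteqP; split=> [b [Tb]|_ ->]; last by split.
  move: Ta Tb => /all_shiftsP[c [g Pg [h Ph <-]]] /all_shiftsP[c' [k Pk [l Pl <-]]].
  by move=> /greenH_shift[] // -> -> ->.
(* Nontriviality excludes the group {1}, over which the semigroup consists of the identity and the
   empty map and is not simple. *)
- exact: all_shifts_simple.
(* These elements show that both kinds are inhabited; uniqueness of the kind then separates the two
   classes. *)
have S11 c : shifts c P (shift c 1 1) by exists 1 => //; exists 1.
split; try exact: shifts_inverse_semigroup.
  apply/seteqP; split=> [_ [f /all_shiftsP[c Sf] <-]|_ [->|->]].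
  - rewrite (green_class_greenD_shift _ _ Sf) //.
    by case: c {Sf}; [left|right].
  - exists (shift true 1 1); first exact: all_shifts_mem.
    exact: green_class_greenD_shift.
  - exists (shift false 1 1); first exact: all_shifts_mem.
    exact: green_class_greenD_shift.
move=> SoS; have := S11 true; rewrite SoS => -[g _ [h _ /(shift_inj hG)[]]] //.
Qed.
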